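(* Let $\phi:X\to Y$ be a map of finite sets and let $l_w$ be the linear Plott function on $X$ corresponding to a simple word $w$ over $X$. Then $\phi_*(l_w)$ is a linear Plott function on $Y$, and it corresponds to the word $\phi_\sharp(w)$, i.e. $\phi_*(l_w)=l_{\phi_\sharp(w)}$.
   Context: A choice function on $X$ is a map $f:2^X\to 2^X$ with $f(A)\subset A$ for all $A\subset X$ (empty values are allowed). $f$ is a Plott function if $f(A\cup B)=f(f(A)\cup B)$ for all $A,B\subset X$; it is linear if $|f(A)|\le 1$ for all $A\subset X$. For a map $\phi:X\to Y$ and a choice function $f$ on $X$, the direct image $\phi_*(f)$ is the choice function on $Y$ given by $\phi_*(f)(B)=\phi(f(\phi^{-1}(B)))$ for $B\subset Y$. A simple word over $X$ is a finite sequence $w=x(1)\dots x(k)$ ($k\ge0$, empty word allowed) of pairwise distinct elements of $X$; $\mathbf{SW}(X)$ is the set of simple words. The linear Plott function $l_w$ corresponding to $w$ is: $l_w(A)=\{x(i)\}$ with $i$ the smallest index such that $x(i)\in A$, and $l_w(A)=\emptyset$ if no letter of $w$ is in $A$. The map $\phi_\sharp:\mathbf{SW}(X)\to\mathbf{SW}(Y)$ is defined as follows: $\phi_\sharp$ of the empty word is the empty word; for $w=vx$ (with last letter $x$), $\phi_\sharp(w)=\phi_\sharp(v)\phi(x)$ if $\phi(x)$ does not occur in the word $\phi(v)$ (obtained by applying $\phi$ to each letter of $v$), and $\phi_\sharp(w)=\phi_\sharp(v)$ otherwise. *)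

(* Defs.v *)
From HB Require Import structures.
From mathcomp Require Import all_boot.

Set Implicit Arguments.
Unset Strict Implicit.
Unset Printing Implicit Defensive.

(* Finite functions are used so that Leibniz equality of choice functions is
   extensional equality. *)
Record choice_fun (X : finType) := ChoiceFun {
  choice_val :> {ffun {set X} -> {set X}};
  choice_valP : [forall A : {set X}, choice_val A \subset A] }.

HB.instance Definition _ (X : finType) := [isSub for @choice_val X].
HB.instance Definition _ (X : finType) := [Equality of choice_fun X by <:].

Definition plott (X : finType) (f : choice_fun X) : Prop :=
  forall A B : {set X}, f (A :|: B) = f (f A :|: B).

Definition linear_choice (X : finType) (f : choice_fun X) : Prop :=
  forall A : {set X}, #|f A| <= 1.

Section DirectImage.
Variables (X Y : finType) (phi : X -> Y) (f : choice_fun X).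

Definition direct_image_val : {ffun {set Y} -> {set Y}} :=
  [ffun B : {set Y} => phi @: f (phi @^-1: B)].

Lemma direct_image_subproof :
  [forall B : {set Y}, direct_image_val B \subset B].
Proof.
apply/forallP => B; rewrite ffunE; apply/subsetP => y /imsetP [x xf ->].
by have /forallP/(_ (phi @^-1: B))/subsetP/(_ x xf) := choice_valP f; rewrite inE.
Qed.

Definition direct_image : choice_fun Y := ChoiceFun direct_image_subproof.

End DirectImage.

Record simple_word (X : finType) := SimpleWord {
  letters :> seq X;
  simple_wordP : uniq letters }.

HB.instance Definition _ (X : finType) := [isSub for @letters X].
HB.instance Definition _ (X : finType) := [Equality of simple_word X by <:].

Section LinearOfWord.
Variables (X : finType) (w : simple_word X).

(* [find] returns the least index whose letter lies in A, or [size w] if there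
   is none, in which case [onth] returns None. *)
Definition word_choice_val : {ffun {set X} -> {set X}} :=
  [ffun A : {set X} =>
     if onth w (find [in A] w) is Some x then [set x] else set0].

Lemma word_choice_subproof : [forall A : {set X}, word_choice_val A \subset A].
Proof.
apply/forallP => A; rewrite ffunE.
elim: (letters w) => [|x s IHs] /=; first exact: sub0set.
by case: ifP => [xA|_] //=; rewrite sub1set.
Qed.

Definition word_choice : choice_fun X := ChoiceFun word_choice_subproof.

End LinearOfWord.

Section Sharp.
Variables (X Y : finType) (phi : X -> Y).

(* The recursion removes the last letter of a word, so it is run on the reversed
   word; [sharp_seq_rcons] gives it in the usual order. *)
Fixpoint sharp_rev (r : seq X) : seq Y :=
  if r is x :: r' then
    if phi x \in map phi (rev r') then sharp_rev r'
    else rcons (sharp_rev r') (phi x)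
  else [::].

Definition sharp_seq (w : seq X) : seq Y := sharp_rev (rev w).

Lemma sharp_seq_nil : sharp_seq [::] = [::].
Proof. by []. Qed.

Lemma sharp_seq_rcons (v : seq X) (x : X) :
  sharp_seq (rcons v x) =
    if phi x \in map phi v then sharp_seq v else rcons (sharp_seq v) (phi x).
Proof. by rewrite /sharp_seq rev_rcons /= revK. Qed.

Lemma mem_sharp_seq (w : seq X) : sharp_seq w =i map phi w.
Proof.
elim/last_ind: w => [|v x IHv] y //.
rewrite sharp_seq_rcons map_rcons mem_rcons inE.
case: ifP => [xv|_]; last by rewrite mem_rcons inE IHv.
by rewrite IHv; case: eqP => // ->.
Qed.

Lemma sharp_seq_uniq (w : seq X) : uniq (sharp_seq w).
Proof.
elim/last_ind: w => [|v x IHv] //; rewrite sharp_seq_rcons.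
by case: ifPn => // xv; rewrite rcons_uniq mem_sharp_seq xv.
Qed.

Definition sharp (w : simple_word X) : simple_word Y :=
  SimpleWord (sharp_seq_uniq w).

End Sharp.

(* Main.v *)
Require Import Defs.
From mathcomp Require Import all_boot.

(** Both [phi_*(l_w)] and the choice function of [phi_sharp(w)] select from [B]
    the value [phi x] of the first letter [x] of [w] whose image lies in [B].
    For [phi_sharp(w)] this holds because [phi_sharp] keeps the first occurrence
    of every letter of the word [phi(w)], so the letters that it drops can never
    be the first to lie in a set.  Since the recursion of [phi_sharp] removes
    the last letter, the proof ([imset_first_in]) is an induction from
    the right: appending [x] to [v] changes the choice from [B] only if no
    letter of [phi(v)] lies in [B], and a dropped [phi x] does occur in [phi(v)].

    Once the direct image is known to be the choice function of a word, the
    Plott and linearity properties are those of word choice functions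
    ([plott_word_choice], [linear_word_choice]). *)

(** The value of a word choice function, for sequences that may repeat letters:
    inductions need not carry proofs of uniqueness. *)
Definition first_in {T : finType} (s : seq T) (A : {set T}) : {set T} :=
  if onth s (find [in A] s) is Some x then [set x] else set0.

Lemma word_choiceE (T : finType) (w : simple_word T) (A : {set T}) :
  word_choice w A = first_in w A.
Proof. by rewrite ffunE. Qed.

Lemma first_in_cons (T : finType) (x : T) (s : seq T) (A : {set T}) :
  first_in (x :: s) A = if x \in A then [set x] else first_in s A.
Proof. by rewrite /first_in /=; case: (x \in A). Qed.

Lemma first_in_rcons (T : finType) (s : seq T) (x : T) (A : {set T}) :
  first_in (rcons s x) A =
    if has [in A] s then first_in s A
    else if x \in A then [set x] else set0.
Proof.
elim: s => [|y s IHs] /=; first by rewrite first_in_cons.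
by rewrite !first_in_cons IHs; case: (y \in A).
Qed.

Lemma first_in_hasN (T : finType) (s : seq T) (A : {set T}) :
  ~~ has [in A] s -> first_in s A = set0.
Proof.
elim: s => //= x s IHs; rewrite negb_or first_in_cons.
by case/andP=> /negbTE-> /IHs.
Qed.

Lemma first_in_sub (T : finType) (s : seq T) (A : {set T}) :
  first_in s A \subset A.
Proof.
elim: s => [|x s IHs]; first exact: sub0set.
by rewrite first_in_cons; case: ifP => // xA; rewrite sub1set.
Qed.

(** Leading letters outside [A :|: B] affect neither side, and the first letter
    inside is chosen by both: if it lies in [A] then it is also the choice from
    [A], otherwise it lies in [B]. *)
Lemma first_in_setU (T : finType) (s : seq T) (A B : {set T}) :
  first_in s (A :|: B) = first_in s (first_in s A :|: B).
Proof.
elim: s => // x s IHs; rewrite !first_in_cons !inE.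
have [xA|xNA] /= := boolP (x \in A); first by rewrite set11.
have [xB|_] /= := boolP (x \in B); first by rewrite orbT.
by rewrite orbF (contraNF (subsetP (first_in_sub T s A) x) xNA).
Qed.

Lemma plott_word_choice (T : finType) (w : simple_word T) :
  plott (word_choice w).
Proof. by move=> A B; rewrite !word_choiceE -first_in_setU. Qed.

Lemma linear_word_choice (T : finType) (w : simple_word T) :
  linear_choice (word_choice w).
Proof.
move=> A; rewrite word_choiceE /first_in.
by case: onth => [x|]; rewrite ?cards1 ?cards0.
Qed.

Lemma has_sharp_seq (X Y : finType) (phi : X -> Y) (s : seq X) (B : {set Y}) :
  has [in B] (sharp_seq phi s) = has [in phi @^-1: B] s.
Proof.
rewrite (eq_has_r (mem_sharp_seq phi s)) has_map.
by apply: eq_has => x /=; rewrite inE.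
Qed.

Lemma imset_first_in (X Y : finType) (phi : X -> Y) (s : seq X) (B : {set Y}) :
  phi @: first_in s (phi @^-1: B) = first_in (sharp_seq phi s) B.
Proof.
elim/last_ind: s => [|v x IHv]; first by rewrite imset0.
rewrite first_in_rcons inE sharp_seq_rcons.
have [phi_x_v | _] := boolP (phi x \in map phi v); last first.
  rewrite first_in_rcons has_sharp_seq -IHv.
  by case: ifP => // _; case: ifP; rewrite ?imset_set1 ?imset0.
have [// | no_v] := ifPn.
(* The dropped [phi x] already occurs in [phi(v)], which has no letter in [B]. *)
rewrite -has_sharp_seq in no_v.
have /negbTE-> : phi x \notin B.
  apply: contra no_v => phi_x_B.
  by apply/hasP; exists (phi x); rewrite ?mem_sharp_seq.
by rewrite imset0 first_in_hasN.
Qed.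

Lemma direct_image_word_choice (X Y : finType) (phi : X -> Y)
    (w : simple_word X) :
  direct_image phi (word_choice w) = word_choice (sharp phi w).
Proof.
apply/val_inj/ffunP => B; rewrite [LHS]ffunE !word_choiceE.
exact: imset_first_in.
Qed.

Theorem lemma2 (X Y : finType) (phi : X -> Y) (w : simple_word X) :
  plott (direct_image phi (word_choice w)) /\
  linear_choice (direct_image phi (word_choice w)) /\
  direct_image phi (word_choice w) = word_choice (sharp phi w).
Proof.
rewrite direct_image_word_choice.
by split; [exact: plott_word_choice | split; first exact: linear_word_choice].
Qed.
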